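(* Let $\beta,\gamma,m$ be real constants. Let $v=v(r,t)$ be a smooth real-valued solution, in a neighbourhood of a point $(r,t)$, of the linear equation $$\frac{\partial^2 v}{\partial t^2}-\frac{\partial^2 v}{\partial r^2}+\gamma\frac{\partial v}{\partial t}-\beta\frac{\partial^3 v}{\partial t\,\partial r^2}+m^2v=0 .$$ For $\Delta t,\Delta r>0$ small, let $\tau_{\Delta t,\Delta r}(r,t)$ be the local truncation error at $(r,t)$ of the finite-difference scheme described in the context, with zero nonlinear term. Then the scheme is consistent of order $\mathcal{O}(\Delta t^2)+\mathcal{O}(\Delta r^2)$ with the equation, that is, $$\tau_{\Delta t,\Delta r}(r,t)=\mathcal{O}(\Delta t^2)+\mathcal{O}(\Delta r^2)\qquad\text{as }(\Delta t,\Delta r)\to(0,0).$$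
   Context: For a function $v(r,t)$ put $\delta^2 v(r,t)=v(r+\Delta r,t)-2v(r,t)+v(r-\Delta r,t)$. The local truncation error of the scheme (with zero nonlinear term) at $(r,t)$ is $$\begin{aligned}\tau_{\Delta t,\Delta r}(r,t)={}&\frac{v(r,t+\Delta t)-2v(r,t)+v(r,t-\Delta t)}{(\Delta t)^2}-\frac{\delta^2v(r,t)}{(\Delta r)^2}+\gamma\frac{v(r,t+\Delta t)-v(r,t-\Delta t)}{2\Delta t}\\&-\beta\frac{\delta^2v(r,t+\Delta t)-\delta^2v(r,t-\Delta t)}{2\Delta t(\Delta r)^2}+\frac{m^2}{2}\bigl[v(r,t+\Delta t)+v(r,t-\Delta t)\bigr].\end{aligned}$$ This is obtained by substituting $v_j^n=v(r_j,t_n)$ into the scheme $$\frac{v_j^{n+1}-2v_j^n+v_j^{n-1}}{(\Delta t)^2}-\frac{\delta_0^2v_j^n}{(\Delta r)^2}+\gamma\frac{v_j^{n+1}-v_j^{n-1}}{2\Delta t}-\beta\frac{\delta_0^2v_j^{n+1}-\delta_0^2v_j^{n-1}}{2\Delta t(\Delta r)^2}+\frac{m^2}{2}\bigl[v_j^{n+1}+v_j^{n-1}\bigr]=0,$$ where $\delta_0^2v_j^n=v_{j+1}^n-2v_j^n+v_{j-1}^n$. The equation for $v$ arises from the radially symmetric three-dimensional linear equation $w_{tt}-\nabla^2w-\beta\,\partial_t\nabla^2w+\gamma w_t+m^2w=0$ via $v=rw$. The notation $\tau=\mathcal{O}(\Delta t^2)+\mathcal{O}(\Delta r^2)$ means that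 there is a constant $C$ (depending on $v$ and $(r,t)$ but not on $\Delta t,\Delta r$) with $|\tau|\le C(\Delta t^2+\Delta r^2)$ for all sufficiently small $\Delta t,\Delta r>0$. *)

(* Defs.v *)
From Stdlib Require Import Reals.
From Coquelicot Require Import Coquelicot.
Open Scope R_scope.

(* Functions of (r, t) are total maps [R -> R -> R], first argument r; all
   hypotheses below only concern their values near the base point. *)

(* Smooth (C^oo) near (r, t): on one common neighbourhood, all iterated partial
   derivatives of every order, in any order of differentiation, exist and are
   jointly continuous. *)
Definition smooth_near (v : R -> R -> R) (r t : R) : Prop :=
  locally_2d (fun x s => forall n : nat, ex_diff_n v n x s) r t.

Definition solves_at (beta gamma m : R) (v : R -> R -> R) (r t : R) : Prop :=
  Derive_n (fun s => v r s) 2 t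
  - Derive_n (fun x => v x t) 2 r
  + gamma * Derive (fun s => v r s) t
  - beta * Derive (fun s => Derive_n (fun x => v x s) 2 r) t
  + m ^ 2 * v r t = 0.

Definition delta2 (dr : R) (v : R -> R -> R) (r t : R) : R :=
  v (r + dr) t - 2 * v r t + v (r - dr) t.

Definition tau (beta gamma m : R) (v : R -> R -> R) (r t dt dr : R) : R :=
  (v r (t + dt) - 2 * v r t + v r (t - dt)) / dt ^ 2
  - delta2 dr v r t / dr ^ 2
  + gamma * ((v r (t + dt) - v r (t - dt)) / (2 * dt))
  - beta * ((delta2 dr v r (t + dt) - delta2 dr v r (t - dt))
            / (2 * dt * dr ^ 2))
  + m ^ 2 / 2 * (v r (t + dt) + v r (t - dt)).

(* err dt dr = O(dt^2) + O(dr^2) as (dt, dr) -> (0, 0) with dt, dr > 0; the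
   two steps tend to 0 independently. *)
Definition order2_error (err : R -> R -> R) : Prop :=
  exists C eps : R, 0 < eps /\
    forall dt dr : R, 0 < dt < eps -> 0 < dr < eps ->
      Rabs (err dt dr) <= C * (dt ^ 2 + dr ^ 2).

(* Main.v *)
Require Import Defs.
From Stdlib Require Import Reals Factorial Lra Lia.
From Coquelicot Require Import Coquelicot.
Open Scope R_scope.

(** Taylor's formula with Lagrange remainder handles the pure differences.
    The mixed quotient is divided by both [dt] and [dr^2], so its remainder must
    carry both factors: one expands [G s = delta2 dr v r s] in time, and uses that
    its time derivatives are again second differences in space, of the time
    derivatives of [v]. *)

(** * Taylor remainders on a fixed interval *)

Lemma locally_of_Rabs_lt (P : R -> Prop) (x d y : R) :
  (forall z, Rabs (z - x) < d -> P z) -> Rabs (y - x) < d ->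
  locally y (fun z => P z).
Proof.
intros HP Hy.
assert (Hd : 0 < d - Rabs (y - x)) by lra.
exists (mkposreal _ Hd); intros z Hz.
change (Rabs (z - y) < d - Rabs (y - x)) in Hz.
apply HP.
replace (z - x) with ((z - y) + (y - x)) by ring.
pose proof (Rabs_triang (z - y) (y - x)); lra.
Qed.

Lemma taylor_right_bound (f : R -> R) (n : nat) (x d M h : R) :
  (forall y k, Rabs (y - x) < d -> ex_derive_n f k y) ->
  (forall y, Rabs (y - x) < d -> Rabs (Derive_n f (S n) y) <= M) ->
  0 < h < d ->
  Rabs (f (x + h) - sum_f_R0 (fun k => h ^ k / INR (fact k) * Derive_n f k x) n)
  <= h ^ S n / INR (fact (S n)) * M.
Proof.
intros Hex HM Hh.
destruct (Taylor_Lagrange f n x (x + h)) as [z [Hz ->]].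
- lra.
- intros y Hy k _; apply Hex, Rabs_def1; lra.
- replace (x + h - x) with h by ring.
  match goal with |- Rabs (?a + ?b - ?a) <= _ =>
    replace (a + b - a) with b by ring end.
  assert (Hc : 0 <= h ^ S n / INR (fact (S n))).
  { apply Rdiv_le_0_compat; [apply pow_le; lra | apply INR_fact_lt_0]. }
  rewrite Rabs_mult, (Rabs_pos_eq _ Hc).
  apply Rmult_le_compat_l; [exact Hc | apply HM, Rabs_def1; lra].
Qed.

(** Reflection: apply the right-hand bound to [fun y => f (- y)] at [- x]. The factor [(-1) ^ k] in
    its [k]-th derivative turns [h ^ k] into [(- h) ^ k] and disappears from the remainder under the
    absolute value. *)
Lemma taylor_left_bound (f : R -> R) (n : nat) (x d M h : R) :
  (forall y k, Rabs (y - x) < d -> ex_derive_n f k y) ->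
  (forall y, Rabs (y - x) < d -> Rabs (Derive_n f (S n) y) <= M) ->
  0 < h < d ->
  Rabs (f (x - h)
        - sum_f_R0 (fun k => (- h) ^ k / INR (fact k) * Derive_n f k x) n)
  <= h ^ S n / INR (fact (S n)) * M.
Proof.
intros Hex HM Hh.
assert (Hopp : forall y, Rabs (y - - x) < d -> Rabs (- y - x) < d).
{ intros y Hy; rewrite <- Rabs_Ropp.
  now replace (- (- y - x)) with (y - - x) by ring. }
assert (Hloc : forall y n, Rabs (y - - x) < d ->
  locally (- y) (fun z => forall k, (k <= n)%nat -> ex_derive_n f k z)).
{ intros y m Hy.
  apply (locally_of_Rabs_lt
    (fun z => forall k, (k <= m)%nat -> ex_derive_n f k z) x d); auto. }
assert (Hx : Rabs (- x - - x) < d).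
{ replace (- x - - x) with 0 by ring; rewrite Rabs_R0; lra. }
pose proof (taylor_right_bound (fun y => f (- y)) n (- x) d M h) as T; cbv beta in T.
replace (- (- x + h)) with (x - h) in T by ring.
erewrite sum_eq; [apply T | ].
- intros y k Hy; apply ex_derive_n_comp_opp; auto.
- intros y Hy; rewrite Derive_n_comp_opp by auto.
  rewrite Rabs_mult, pow_1_abs, Rmult_1_l; auto.
- exact Hh.
- intros k _; cbv beta; rewrite Derive_n_comp_opp by auto.
  rewrite Ropp_involutive.
  replace (- h) with (-1 * h) by ring; rewrite Rpow_mult_distr.
  unfold Rdiv; ring.
Qed.

(** * Central differences in one variable *)

Lemma second_difference_bound (f : R -> R) (x d M h : R) :
  (forall y k, Rabs (y - x) < d -> ex_derive_n f k y) ->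
  (forall y, Rabs (y - x) < d -> Rabs (Derive_n f 2 y) <= M) ->
  0 < h < d ->
  Rabs (f (x + h) - 2 * f x + f (x - h)) <= M * h ^ 2.
Proof.
intros Hex HM Hh.
pose proof (taylor_right_bound f 1 x d M h Hex HM Hh) as R1.
pose proof (taylor_left_bound f 1 x d M h Hex HM Hh) as R2.
simpl in R1, R2; apply Rabs_le_between in R1, R2.
apply Rabs_le; simpl; lra.
Qed.

(** The odd-order terms of the two cubic expansions cancel, and two remainders [M * h ^ 4 / 24] add
    up. *)
Lemma second_difference_error (f : R -> R) (x d M h : R) :
  (forall y k, Rabs (y - x) < d -> ex_derive_n f k y) ->
  (forall y, Rabs (y - x) < d -> Rabs (Derive_n f 4 y) <= M) ->
  0 < h < d ->
  Rabs (f (x + h) - 2 * f x + f (x - h) - h ^ 2 * Derive_n f 2 x)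
  <= M * h ^ 4 / 12.
Proof.
intros Hex HM Hh.
pose proof (taylor_right_bound f 3 x d M h Hex HM Hh) as R1.
pose proof (taylor_left_bound f 3 x d M h Hex HM Hh) as R2.
simpl in R1, R2; apply Rabs_le_between in R1, R2.
apply Rabs_le; simpl; lra.
Qed.

(** Here the even-order terms cancel, leaving two remainders [M * h ^ 3 / 6]. *)
Lemma central_difference_error (f : R -> R) (x d M h : R) :
  (forall y k, Rabs (y - x) < d -> ex_derive_n f k y) ->
  (forall y, Rabs (y - x) < d -> Rabs (Derive_n f 3 y) <= M) ->
  0 < h < d ->
  Rabs (f (x + h) - f (x - h) - 2 * h * Derive_n f 1 x) <= M * h ^ 3 / 3.
Proof.
intros Hex HM Hh.
pose proof (taylor_right_bound f 2 x d M h Hex HM Hh) as R1.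
pose proof (taylor_left_bound f 2 x d M h Hex HM Hh) as R2.
simpl in R1, R2; apply Rabs_le_between in R1, R2.
apply Rabs_le; simpl; lra.
Qed.

(** * Consequences of smoothness in two variables *)

Lemma smooth_ex_derive_n_r (v : R -> R -> R) (p k : nat) (x s : R) :
  (forall n, ex_diff_n v n x s) ->
  ex_derive_n (fun y => partial_derive 0 k v y s) p x.
Proof.
intros H; destruct p as [|p]; [exact I|].
apply (ex_diff_n_ex_deriv_inf_1 (S (p + k)) p k); auto; lia.
Qed.

Lemma smooth_ex_derive_n_t (v : R -> R -> R) (k : nat) (x s : R) :
  (forall n, ex_diff_n v n x s) -> ex_derive_n (fun z => v x z) k s.
Proof.
intros H; destruct k as [|k]; [exact I|].
apply (ex_diff_n_ex_deriv_inf_2 (S (0 + k)) 0 k); auto; lia.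
Qed.

Lemma partial_derive_locally_bounded (v : R -> R -> R) (p k : nat) (r t : R) :
  smooth_near v r t ->
  exists M, locally_2d (fun x s => Rabs (partial_derive p k v x s) <= M) r t.
Proof.
intros H; apply locally_2d_singleton in H.
assert (Hc : continuity_2d_pt (partial_derive p k v) r t).
(* Taking exactly [p + k] derivatives leaves order 0, which is joint continuity. *)
{ pose proof (ex_diff_n_deriv (p + k) p k (le_n _) v r t (H _)) as E.
  rewrite Nat.sub_diag in E; apply E. }
exists (Rabs (partial_derive p k v r t) + 1).
destruct (Hc (mkposreal 1 Rlt_0_1)) as [d Hd].
exists d; intros x s Hx Hs; specialize (Hd x s Hx Hs); simpl in Hd.
pose proof (Rabs_triang_inv (partial_derive p k v x s)
  (partial_derive p k v r t)); lra.
Qed.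

(** One explicit radius for both variables, so that the one-variable Taylor bounds hold uniformly in
    both step sizes. *)
Definition smooth_on_box (v : R -> R -> R) (r t d : R) : Prop :=
  forall x s, Rabs (x - r) < d -> Rabs (s - t) < d -> forall n, ex_diff_n v n x s.

Lemma Rabs_shift_lt (x h d : R) :
  0 < h < d -> Rabs (x + h - x) < d /\ Rabs (x - x) < d /\ Rabs (x - h - x) < d.
Proof. intros Hh; repeat split; apply Rabs_def1; lra. Qed.

(** Linearity of differentiation in time, applied at the three space points [r + dr], [r], [r - dr],
    all inside the box. *)
Lemma is_derive_n_delta2 (v : R -> R -> R) (r t d dr s : R) (k : nat) :
  smooth_on_box v r t d -> 0 < dr < d -> Rabs (s - t) < d ->
  is_derive_n (fun z => delta2 dr v r z) k s
    (delta2 dr (partial_derive 0 k v) r s).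
Proof.
intros Hv Hdr Hs; destruct (Rabs_shift_lt r dr d Hdr) as [H1 [H2 H3]].
assert (Hex : forall x z n, Rabs (x - r) < d -> Rabs (z - t) < d ->
  ex_derive_n (fun z => v x z) n z).
{ intros x z n Hx Hz; apply smooth_ex_derive_n_t; auto. }
(* The sum and difference rules for [k]-th derivatives ask for all lower derivatives near [s], so
   this is prepared for each partial combination. *)
assert (Hloc : forall x n, Rabs (x - r) < d -> locally s
  (fun z => forall k, (k <= n)%nat -> ex_derive_n (fun z => v x z) k z)).
{ intros x n Hx; apply (locally_of_Rabs_lt
    (fun z => forall k, (k <= n)%nat -> ex_derive_n (fun z => v x z) k z) t d);
    auto. }
assert (Hloc2 : forall n, locally s (fun z => forall k, (k <= n)%nat ->
  ex_derive_n (fun z => 2 * v r z) k z)).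
{ intros n; generalize (Hloc r n H2); apply filter_imp.
  intros z Hz j Hj; apply ex_derive_n_scal_l; auto. }
assert (Hloc3 : forall n, locally s (fun z => forall k, (k <= n)%nat ->
  ex_derive_n (fun z => v (r + dr) z - 2 * v r z) k z)).
{ intros n; generalize (filter_and _ _ (locally_locally _ _ (Hloc2 n))
    (locally_locally _ _ (Hloc (r + dr) n H1))).
  apply filter_imp; intros z [Hz Hz'] j Hj; apply ex_derive_n_minus.
  - generalize Hz'; apply filter_imp; intros y Hy i Hi; apply Hy; lia.
  - generalize Hz; apply filter_imp; intros y Hy i Hi; apply Hy; lia. }
unfold delta2; apply is_derive_n_plus; auto.
- apply is_derive_n_minus; auto.
  + apply Derive_n_correct; auto.
  + apply is_derive_n_scal_l, Derive_n_correct; auto.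
- apply Derive_n_correct; auto.
Qed.

(** The first term is the time error of the central difference of [delta2], whose third time
    derivative is at most [M23 * dr ^ 2]. The second is [2 * dt] times the space error of the second
    difference of the time derivative of [v]. *)
Lemma mixed_difference_error (v : R -> R -> R) (r t d M23 M41 dt dr : R) :
  smooth_on_box v r t d ->
  (forall x s, Rabs (x - r) < d -> Rabs (s - t) < d ->
    Rabs (partial_derive 2 3 v x s) <= M23) ->
  (forall x s, Rabs (x - r) < d -> Rabs (s - t) < d ->
    Rabs (partial_derive 4 1 v x s) <= M41) ->
  0 < dt < d -> 0 < dr < d ->
  Rabs (delta2 dr v r (t + dt) - delta2 dr v r (t - dt)
        - 2 * dt * dr ^ 2 * partial_derive 2 1 v r t)
  <= M23 * dr ^ 2 * dt ^ 3 / 3 + 2 * dt * (M41 * dr ^ 4 / 12).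
Proof.
intros Hv H23 H41 Hdt Hdr.
destruct (Rabs_shift_lt t dt d Hdt) as [_ [Ht _]].
assert (HG : forall k s, Rabs (s - t) < d ->
  Derive_n (fun z => delta2 dr v r z) k s
  = delta2 dr (partial_derive 0 k v) r s).
{ intros k s Hs; apply is_derive_n_unique; now apply (is_derive_n_delta2 v r t d). }
assert (E1 : Rabs (delta2 dr v r (t + dt) - delta2 dr v r (t - dt)
    - 2 * dt * delta2 dr (partial_derive 0 1 v) r t) <= M23 * dr ^ 2 * dt ^ 3 / 3).
{ rewrite <- HG by exact Ht.
  apply (central_difference_error (fun z => delta2 dr v r z) t d); auto.
  - intros s k Hs; pose proof (is_derive_n_delta2 v r t d dr s k Hv Hdr Hs) as D.
    destruct k; [exact I | eexists; exact D].
  - intros s Hs; rewrite HG by exact Hs.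
    apply (second_difference_bound
      (fun x => partial_derive 0 3 v x s) r d); auto.
    + intros y k Hy; apply smooth_ex_derive_n_r; auto.
    + intros y Hy; apply (H23 y s); auto. }
assert (E2 : Rabs (delta2 dr (partial_derive 0 1 v) r t
    - dr ^ 2 * partial_derive 2 1 v r t) <= M41 * dr ^ 4 / 12).
{ apply (second_difference_error (fun x => partial_derive 0 1 v x t) r d); auto.
  - intros y k Hy; apply smooth_ex_derive_n_r; auto.
  - intros y Hy; apply (H41 y t); auto. }
apply Rabs_le_between in E1, E2.
assert (E3 : forall a b, a <= b -> 2 * dt * a <= 2 * dt * b).
{ intros a b Hab; apply Rmult_le_compat_l; lra. }
pose proof (E3 _ _ (proj1 E2)) as E4; pose proof (E3 _ _ (proj2 E2)) as E5.
apply Rabs_le; lra.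
Qed.

(** * Assembling the truncation error *)

Lemma Rabs_div_minus_le (a b c q : R) :
  0 < b -> Rabs (a - b * q) <= c * b -> Rabs (a / b - q) <= c.
Proof.
intros Hb H; replace (a / b - q) with ((a - b * q) / b) by (field; lra).
unfold Rdiv; rewrite Rabs_mult, (Rabs_pos_eq (/ b)).
- now apply Rle_div_l.
- now left; apply Rinv_0_lt_compat.
Qed.

Lemma Rabs_mult_le_compat (c x y : R) :
  Rabs x <= y -> Rabs (c * x) <= Rabs c * y.
Proof.
intros H; rewrite Rabs_mult; apply Rmult_le_compat_l; [apply Rabs_pos | exact H].
Qed.

Theorem mainTheorem1 (beta gamma m : R) (v : R -> R -> R) (r t : R)
  (v_smooth : smooth_near v r t)
  (v_solves : locally_2d (solves_at beta gamma m v) r t) :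
  order2_error (tau beta gamma m v r t).
Proof.
apply locally_2d_singleton in v_solves.
destruct (partial_derive_locally_bounded v 0 4 r t v_smooth) as [M04 B04].
destruct (partial_derive_locally_bounded v 4 0 r t v_smooth) as [M40 B40].
destruct (partial_derive_locally_bounded v 0 3 r t v_smooth) as [M03 B03].
destruct (partial_derive_locally_bounded v 0 2 r t v_smooth) as [M02 B02].
destruct (partial_derive_locally_bounded v 2 3 r t v_smooth) as [M23 B23].
destruct (partial_derive_locally_bounded v 4 1 r t v_smooth) as [M41 B41].
(* The equation differentiates in [r] first, whereas [partial_derive 2 1] differentiates in [t]
   first; smoothness near the point lets the two orders be exchanged. *)
assert (Hmixed : Derive (fun s => partial_derive 2 0 v r s) t
                 = partial_derive 2 1 v r t).
{ apply Derive_partial_derive; generalize v_smooth.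
  apply locally_2d_impl, locally_2d_forall; auto. }
destruct (locally_2d_and _ _ _ _ v_smooth (locally_2d_and _ _ _ _ B04
  (locally_2d_and _ _ _ _ B40 (locally_2d_and _ _ _ _ B03
  (locally_2d_and _ _ _ _ B02 (locally_2d_and _ _ _ _ B23 B41)))))) as [d Hd].
clear v_smooth B04 B40 B03 B02 B23 B41.
assert (Hv : smooth_on_box v r t d) by (intros x s Hx Hs; now apply Hd).
assert (Hc : forall x, Rabs (x - x) < d).
{ intros x; rewrite Rminus_diag, Rabs_R0; apply cond_pos. }
assert (Hext : forall s k, Rabs (s - t) < d -> ex_derive_n (fun z => v r z) k s).
{ intros s k Hs; apply smooth_ex_derive_n_t; auto. }
unfold solves_at in v_solves.
change (Derive (fun s => Derive_n (fun x => v x s) 2 r) t)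
  with (Derive (fun s => partial_derive 2 0 v r s) t) in v_solves.
rewrite Hmixed in v_solves.
(* [K] adds up the coefficients of [dt ^ 2] and [dr ^ 2] in the error bounds of the five terms of
   [tau]. *)
set (K := M04 / 12 + M40 / 12 + Rabs gamma * (M03 / 6)
          + Rabs beta * (M23 / 6 + M41 / 12) + m ^ 2 / 2 * M02).
exists K, d; split; [apply cond_pos|]; intros dt dr Hdt Hdr.
assert (Pt : 0 < dt ^ 2) by (apply pow_lt; lra).
assert (Pr : 0 < dr ^ 2) by (apply pow_lt; lra).
assert (M_nonneg : 0 <= M04 /\ 0 <= M40 /\ 0 <= M03 /\ 0 <= M02 /\ 0 <= M23
                   /\ 0 <= M41).
{ destruct (Hd r t (Hc r) (Hc t)) as [_ H].
  repeat split; eapply Rle_trans; try apply Rabs_pos; apply H. }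
assert (Ett : Rabs ((v r (t + dt) - 2 * v r t + v r (t - dt)) / dt ^ 2
    - Derive_n (fun s => v r s) 2 t) <= M04 / 12 * dt ^ 2).
{ apply Rabs_div_minus_le; [exact Pt|].
  eapply Rle_trans; [apply (second_difference_error _ t d M04); auto |
    right; field].
  intros y Hy; now apply (Hd r y). }
assert (Err : Rabs (delta2 dr v r t / dr ^ 2
    - Derive_n (fun x => v x t) 2 r) <= M40 / 12 * dr ^ 2).
{ apply Rabs_div_minus_le; [exact Pr|].
  eapply Rle_trans; [apply (second_difference_error (fun x => v x t) r d M40);
    auto | right; field].
  - intros y k Hy; apply (smooth_ex_derive_n_r v k 0); auto.
  - intros y Hy; now apply (Hd y t). }
assert (Et : Rabs ((v r (t + dt) - v r (t - dt)) / (2 * dt)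
    - Derive (fun s => v r s) t) <= M03 / 6 * dt ^ 2).
{ apply Rabs_div_minus_le; [lra|].
  eapply Rle_trans; [apply (central_difference_error _ t d M03); auto |
    right; field].
  intros y Hy; now apply (Hd r y). }
assert (Emix : Rabs ((delta2 dr v r (t + dt) - delta2 dr v r (t - dt))
    / (2 * dt * dr ^ 2) - partial_derive 2 1 v r t)
    <= M23 / 6 * dt ^ 2 + M41 / 12 * dr ^ 2).
{ apply Rabs_div_minus_le; [apply Rmult_lt_0_compat; lra|].
  eapply Rle_trans; [apply (mixed_difference_error v r t d M23 M41); auto |
    right; field].
  - intros x s Hx Hs; destruct (Hd x s Hx Hs) as (_ & _ & _ & _ & _ & H & _).
    exact H.
  - intros x s Hx Hs; destruct (Hd x s Hx Hs) as (_ & _ & _ & _ & _ & _ & H).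
    exact H. }
(* The mass term averages [v] over two time levels; twice its deviation from [v r t] is this second
   difference. *)
assert (Em : Rabs (v r (t + dt) - 2 * v r t + v r (t - dt)) <= M02 * dt ^ 2).
{ apply (second_difference_bound (fun s => v r s) t d); auto.
  intros y Hy; now apply (Hd r y). }
apply (Rabs_mult_le_compat gamma) in Et.
apply (Rabs_mult_le_compat beta) in Emix.
apply (Rabs_mult_le_compat (m ^ 2 / 2)) in Em.
assert (Pm : 0 <= m ^ 2 / 2) by (pose proof (pow2_ge_0 m); lra).
rewrite (Rabs_pos_eq _ Pm) in Em.
apply Rle_trans with (M04 / 12 * dt ^ 2 + M40 / 12 * dr ^ 2
  + Rabs gamma * (M03 / 6 * dt ^ 2)
  + Rabs beta * (M23 / 6 * dt ^ 2 + M41 / 12 * dr ^ 2)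
  + m ^ 2 / 2 * (M02 * dt ^ 2)).
(* Subtracting the equation, whose left side is 0, makes [tau] the signed sum of the five errors. *)
- apply Rabs_le_between in Ett, Err, Et, Emix, Em.
  unfold tau; apply Rabs_le; lra.
(* The gap to [K * (dt ^ 2 + dr ^ 2)] consists of six cross terms, each nonnegative because the
   bounds [M04], ..., [M41] dominate absolute values. *)
- unfold K.
  pose proof (Rabs_pos gamma); pose proof (Rabs_pos beta).
  assert (Q : forall a b c, 0 <= a -> 0 <= b -> 0 < c -> 0 <= a * b * c).
  { intros a b c Ha Hb Hpc; repeat apply Rmult_le_pos; lra. }
  assert (0 <= 1 * M04 * dr ^ 2) by (apply Q; lra).
  assert (0 <= 1 * M40 * dt ^ 2) by (apply Q; lra).
  assert (0 <= Rabs gamma * M03 * dr ^ 2) by (apply Q; lra).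
  assert (0 <= Rabs beta * M23 * dr ^ 2) by (apply Q; lra).
  assert (0 <= Rabs beta * M41 * dt ^ 2) by (apply Q; lra).
  assert (0 <= m ^ 2 / 2 * M02 * dr ^ 2) by (apply Q; lra).
  lra.
Qed.
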